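(* Let $A\in\mathbb{R}^{N\times N}$ be symmetric positive definite with smallest and largest eigenvalues $\lambda_{\min},\lambda_{\max}$, and let $\mathbf{c}\in\mathbb{R}^N$. Let $\check{\mathbf{Q}}_M,\check{\mathbf{T}}_M$ be the matrices produced by the finite-precision Lanczos process, with $\epsilon_0,\epsilon_1,\epsilon_2$ and the standing properties as in the context, and assume $\lambda_{\min}>(M+1)^{5/2}\epsilon_2\|A\|_2$. Let $\boldsymbol{\xi}_k=[\xi_1,\dots,\xi_k]\in\mathbb{C}^k$ be a list of poles closed under complex conjugation, none of which lies in $[\lambda_{\min}-M^{5/2}\epsilon_2\|A\|_2,\ \lambda_{\max}+M^{5/2}\epsilon_2\|A\|_2]$. Let $X_M$ be the unique solution of $\check{\mathbf{T}}_MX_M+X_M\check{\mathbf{T}}_M=\|\mathbf{c}\|_2^2\mathbf{e}_1\mathbf{e}_1^T$ and $$\boldsymbol{\rho}_M=A\check{\mathbf{Q}}_MX_M\check{\mathbf{Q}}_M^T+\check{\mathbf{Q}}_MX_M\check{\mathbf{Q}}_M^TA-\mathbf{c}\mathbf{c}^T .$$ Let $\mathbf{U}_{M,k}\in\mathbb{R}^{M\times k}$ have orthonormal columns forming a basis of the rational Krylov subspace $\mathcal{Q}(\check{\mathbf{T}}_M,\mathbf{e}_1,\boldsymbol{\xi}_k)$, let $Y_{M,k}$ be the solution of $$\mathbf{U}_{M,k}^T\check{\mathbf{T}}_M\mathbf{U}_{M,k}Y_{M,k}+Y_{M,k}\mathbf{U}_{M,k}^T\check{\mathbf{T}}_M\mathbf{U}_{M,k}=\|\mathbf{c}\|_2^2(\mathbf{U}_{M,k}^T\mathbf{e}_1)(\mathbf{U}_{M,k}^T\mathbf{e}_1)^T,$$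 and let $X_{\mathtt{ref}}=\check{\mathbf{Q}}_M\mathbf{U}_{M,k}Y_{M,k}\mathbf{U}_{M,k}^T\check{\mathbf{Q}}_M^T$. Then $$\frac{\|AX_{\mathtt{ref}}+X_{\mathtt{ref}}A-\mathbf{c}\mathbf{c}^T\|_F}{\|\mathbf{c}\|_2^2}\le\frac{\|\boldsymbol{\rho}_M\|_F}{\|\mathbf{c}\|_2^2}+C_3\cdot\widetilde h,$$ where $$C_3=\frac{2(1+2\epsilon_0)M\lambda_{\max}}{\lambda_{\min}-M^{5/2}\epsilon_2\|A\|_2},\qquad \widetilde h=h\bigl(\boldsymbol{\xi}_k,\ \lambda_{\min}-M^{5/2}\epsilon_2\|A\|_2,\ \lambda_{\max}+M^{5/2}\epsilon_2\|A\|_2\bigr),$$ and $h(\boldsymbol{\xi}_k,a,b):=\max_{z\in[a,b]}\dfrac{\prod_{i=1}^k|z+\bar\xi_i|^2}{\prod_{i=1}^k|z-\xi_i|^2}$.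
   Context: Exact Lanczos process: $\beta_0=0$, $\mathbf{q}_0=0$, $\mathbf{q}_1=\mathbf{c}/\|\mathbf{c}\|_2$, and for $j=1,2,\dots$: $\mathbf{w}=A\mathbf{q}_j-\beta_{j-1}\mathbf{q}_{j-1}$, $\alpha_j=\mathbf{q}_j^T\mathbf{w}$, $\mathbf{w}\leftarrow\mathbf{w}-\alpha_j\mathbf{q}_j$, $\beta_j=\|\mathbf{w}\|_2$, $\mathbf{q}_{j+1}=\mathbf{w}/\beta_j$ (no reorthogonalization). It is assumed throughout that $M<N$ and that no breakdown occurs. When it is run in floating-point arithmetic with unit roundoff $\epsilon$, the computed quantities after $M$ iterations are denoted $\check{\mathbf{Q}}_M\in\mathbb{R}^{N\times M}$, $\check{\mathbf{q}}_{M+1}\in\mathbb{R}^N$, $\check\beta_M$, and the symmetric tridiagonal matrix $\check{\mathbf{T}}_M\in\mathbb{R}^{M\times M}$ (diagonal $\check\alpha_1,\dots,\check\alpha_M$, off-diagonal $\check\beta_1,\dots,\check\beta_{M-1}$). Set $\check{\mathbf{Q}}_{M+1}=[\check{\mathbf{Q}}_M,\check{\mathbf{q}}_{M+1}]$ and $$\epsilon_0=2(N+4)\epsilon,\quad \epsilon_1=2\Bigl(7+s\frac{\||A|\|_2}{\|A\|_2}\Bigr)\epsilon,\quad \epsilon_2=\sqrt2\max\{6\epsilon_0,\epsilon_1\},$$ where $|A|$ is the elementwise absolute value and $s$ the maximum number of nonzeros in any row of $A$. The analysis uses the following known properties of the finite-precision Lanczos process (Paige; valid under mild conditions on $\epsilon_0,\epsilon_1$,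 which are assumed): (i) $A\check{\mathbf{Q}}_M=\check{\mathbf{Q}}_M\check{\mathbf{T}}_M+\check\beta_M\check{\mathbf{q}}_{M+1}\mathbf{e}_M^T+F_M$ with $\|F_M\|_F\le\sqrt M\,\epsilon_1\|A\|_2$; (ii) the spectrum of $\check{\mathbf{T}}_M$ is contained in $[\lambda_{\min}-M^{5/2}\epsilon_2\|A\|_2,\ \lambda_{\max}+M^{5/2}\epsilon_2\|A\|_2]$; (iii) $\|\check{\mathbf{Q}}_M\|_F\le\sqrt{(1+2\epsilon_0)M}$ and $\|\check{\mathbf{Q}}_{M+1}\|_F\le\sqrt{(1+2\epsilon_0)(M+1)}$. All computations other than the Lanczos process are assumed exact. Rational Krylov subspace: for $S\in\mathbb{R}^{M\times M}$ having no eigenvalue among the poles and $\mathbf{b}\in\mathbb{R}^M$, $\mathcal{Q}(S,\mathbf{b},\boldsymbol{\xi}_k)=\{p(S)q(S)^{-1}\mathbf{b}: p\in\mathcal{P}_{k-1}\}$, where $q(z)=(z-\xi_1)\cdots(z-\xi_k)$ and $\mathcal{P}_{k-1}$ is the set of real polynomials of degree at most $k-1$; it is assumed throughout that its dimension is $k$. $\mathbf{e}_j$ denotes the $j$th unit vector of appropriate size. *)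

(* Defs.v *)
From HB Require Import structures.
From mathcomp Require Export all_boot all_order all_algebra.
From mathcomp Require Export all_classical all_reals all_analysis.
From mathcomp Require Export complex.

Set Implicit Arguments.
Unset Strict Implicit.
Unset Printing Implicit Defensive.

Import Order.TTheory GRing.Theory Num.Theory.
Local Open Scope classical_set_scope.
Local Open Scope ring_scope.

Section Norms.
Variable R : realType.

Definition norm2 n (x : 'cV[R]_n) : R := Num.sqrt (\sum_i x i 0 ^+ 2).

Definition normF m n (B : 'M[R]_(m, n)) : R :=
  Num.sqrt (\sum_i \sum_j B i j ^+ 2).

(* the matrix norm induced by norm2 *)
Definition spnorm m n (B : 'M[R]_(m, n)) : R :=
  sup [set norm2 (B *m x) / norm2 x | x in [set x : 'cV[R]_n | x != 0]].

Definition posdefmx n (B : 'M[R]_n) : Prop :=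
  B^T = B /\ forall x : 'cV[R]_n, x != 0 -> 0 < (x^T *m B *m x) 0 0.

Definition min_eigenvalue n (B : 'M[R]_n) (a : R) : Prop :=
  eigenvalue B a /\ forall b, eigenvalue B b -> a <= b.

Definition max_eigenvalue n (B : 'M[R]_n) (a : R) : Prop :=
  eigenvalue B a /\ forall b, eigenvalue B b -> b <= a.

(* maximum number of nonzero entries in a row *)
Definition row_nnz m n (B : 'M[R]_(m, n)) : nat :=
  \max_(i < m) #|[pred j | B i j != 0%R]|.

End Norms.

(* Standard model of floating-point arithmetic: an elementary operation whose
   exact result is x may return any y = x (1 + d) with |d| <= u.  Sums may be
   evaluated in any order and with any bracketing. *)
Section FloatingPoint.
Variables (R : realType) (u : R).

Definition rounded (x y : R) : Prop := exists2 d, `|d| <= u & y = x * (1 + d).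

Inductive fl_sum : seq R -> R -> Prop :=
| FlSumNil : fl_sum [::] 0
| FlSumOne x : fl_sum [:: x] x
| FlSumAdd r s t x y z : s != [::] -> t != [::] -> perm_eq r (s ++ t) ->
    fl_sum s x -> fl_sum t y -> rounded (x + y) z -> fl_sum r z.

(* The terms with x i 0 = 0 are left out: multiplying by 0 and adding 0 are
   exact, so they contribute no rounding error. *)
Definition fl_dot n (x y : 'cV[R]_n) (z : R) : Prop :=
  exists2 p : 'I_n -> R, (forall i, rounded (x i 0 * y i 0) (p i))
    & fl_sum [seq p i | i <- enum 'I_n & x i 0 != 0] z.

Definition fl_mulmx m n (B : 'M[R]_(m, n)) (x : 'cV[R]_n) (y : 'cV[R]_m) :
    Prop :=
  forall i, fl_dot (row i B)^T x (y i 0).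

(* y is a computed value of v - a x *)
Definition fl_subscale n (v : 'cV[R]_n) (a : R) (x y : 'cV[R]_n) : Prop :=
  forall i, exists2 p, rounded (a * x i 0) p & rounded (v i 0 - p) (y i 0).

Definition fl_norm2 n (x : 'cV[R]_n) (b : R) : Prop :=
  exists2 t, fl_dot x x t & rounded (Num.sqrt t) b.

(* y is a computed value of x / b *)
Definition fl_scaleV n (x : 'cV[R]_n) (b : R) (y : 'cV[R]_n) : Prop :=
  forall i, rounded (x i 0 / b) (y i 0).

Section Lanczos.
Variables (n : nat) (A : 'M[R]_n) (c : 'cV[R]_n).
Variables (q : nat -> 'cV[R]_n) (alpha beta : nat -> R).

Definition fl_lanczos_init : Prop :=
  [/\ q 0 = 0, beta 0 = 0
    & exists b, [/\ fl_norm2 c b, b != 0 & fl_scaleV c b (q 1)]].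

Definition fl_lanczos_step (j : nat) : Prop :=
  exists v w w' : 'cV[R]_n,
    [/\ fl_mulmx A (q j) v, fl_subscale v (beta j.-1) (q j.-1) w,
        fl_dot (q j) w (alpha j) & fl_subscale w (alpha j) (q j) w'] /\
    [/\ fl_norm2 w' (beta j), beta j != 0 & fl_scaleV w' (beta j) (q j.+1)].

(* q, alpha and beta are the quantities computed by M iterations without
   breakdown; values beyond iteration M are irrelevant. *)
Definition fl_lanczos (M : nat) : Prop :=
  fl_lanczos_init /\ forall j, (1 <= j <= M)%N -> fl_lanczos_step j.

End Lanczos.
End FloatingPoint.

(* Vectors and coefficients of the Lanczos process are numbered from 1, rows and
   columns of matrices from 0. *)
Section LanczosMatrices.
Variable R : realType.

Definition lanczos_basis n (q : nat -> 'cV[R]_n) (M : nat) : 'M[R]_(n, M) :=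
  \matrix_(i < n, j < M) q j.+1 i 0.

Definition lanczos_tridiag (alpha beta : nat -> R) (M : nat) : 'M[R]_M :=
  \matrix_(i < M, j < M)
    if i == j then alpha i.+1
    else if i.+1 == j :> nat then beta i.+1
    else if j.+1 == i :> nat then beta j.+1
    else 0.

Definition eps0 (N : nat) (eps : R) : R := 2 * (N%:R + 4) * eps.

Definition eps1 N (A : 'M[R]_N) (eps : R) : R :=
  2 * (7 + (row_nnz A)%:R * (spnorm (map_mx Num.norm A) / spnorm A)) * eps.

Definition eps2 N (A : 'M[R]_N) (eps : R) : R :=
  Num.sqrt 2 * Num.max (6 * eps0 N eps) (eps1 A eps).

End LanczosMatrices.

Section Rational.
Variable R : realType.
Local Open Scope complex_scope.

Local Notation toC := (real_complex R).

(* As lists, i.e. conjugate poles have equal multiplicities. *)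
Definition conj_closed (xi : seq R[i]) : Prop :=
  perm_eq [seq conjc z | z <- xi] xi.

Definition pole_poly (xi : seq R[i]) : {poly R[i]} :=
  \prod_(z <- xi) ('X - z%:P).

(* The poles are complex, so p(S) q(S)^-1 b is computed over R[i]. *)
Definition rat_krylov n (S : 'M[R]_n.+1) (b : 'cV[R]_n.+1) (xi : seq R[i]) :
    set 'cV[R]_n.+1 :=
  [set v | exists2 p : {poly R}, (size p <= size xi)%N
     & map_mx toC v = horner_mx (map_mx toC S) (map_poly toC p)
         *m invmx (horner_mx (map_mx toC S) (pole_poly xi)) *m map_mx toC b].

Definition orthonormal_basis n k (U : 'M[R]_(n, k)) (V : set 'cV[R]_n) : Prop :=
  U^T *m U = 1%:M /\ V = range (fun y : 'cV[R]_k => U *m y).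

(* When no pole lies in [a, b], the supremum is a maximum by compactness. *)
Definition pole_ratio (xi : seq R[i]) (a b : R) : R :=
  sup [set (\prod_(z <- xi) Normc.normc (x%:C + conjc z) ^+ 2)
           / (\prod_(z <- xi) Normc.normc (x%:C - z) ^+ 2)
      | x in `[a, b]].

End Rational.

(* Main.v *)
Require Import Defs.
From mathcomp Require Import ring lra zify.
Set Implicit Arguments.
Unset Strict Implicit.
Unset Printing Implicit Defensive.
Import Order.TTheory GRing.Theory Num.Theory.
Local Open Scope classical_set_scope.
Local Open Scope complex_scope.
Local Open Scope ring_scope.

(** The projected solution differs from the one built on the full tridiagonal
    matrix T by E = X - U Y U^T, and the two residuals differ by
    A Q E Q^T + Q E Q^T A.  By [residual_perturbation] the norm of this term is
    at most 2 lmax |Q|_F^2 |E|_F, and |Q|_F^2 is bounded by hypothesis, so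
    everything rests on the bound |E|_F <= h |c|^2 / (2 a), where h is the pole
    ratio and a a lower bound for the spectrum of T ([rational_galerkin_error]).
    Rounding errors enter this difference only through the bounds on Q and on the spectrum of T.

    Write L(Z) = T Z + Z T.  Since T is symmetric with spectrum above a > 0, L
    is self-adjoint for the Frobenius inner product and bounded below by 2 a
    ([lyap_coercive]), so <Z, L(Z)> is the square of an energy norm.  The
    equation for Y is the Galerkin condition for L, hence U Y U^T minimizes the
    energy of X - U Z U^T over all Z ([galerkin_energy_optimal]), and a single
    good competitor suffices.

    The competitor is the approximation that the ADI iteration would produce
    with the poles as shifts: its error is r(T) X r(T) with r(t) = q(-t)/q(t)
    and q the polynomial whose roots are the poles.  The columns and rows of
    X - r(T) X r(T) lie in the rational Krylov space ([adi_in_krylov]): the rank-one displacement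
    T W + W T = w w^T lets a polynomial in T move across W, replacing T by -T,
    at the price of terms in the Krylov space of w ([krylov_displacement]).
    In an eigenbasis of T, L multiplies entry (i, j) by d_i + d_j and the map
    X |-> r(T) X r(T) multiplies it by r(d_i) r(d_j), where r(d_i)^2 <= h; so
    the energy norm of the ADI error is at most h times that of X
    ([lyap_energy_horner_le]).  Finally <X, L(X)> <= |c|^4 / (2 a)
    ([lyap_energy_apriori]), and coercivity turns the energy bound into the
    bound on |E|_F.

    The diagonalization is the real spectral theorem ([symmetric_spectral]),
    obtained by splitting off one eigenvector at a time with a Householder
    reflection. *)

(** * The Frobenius inner product *)

Section Frobenius.
Variable R : realType.

Lemma sum_sqr_ge0 (I : finType) (f : I -> R) : 0 <= \sum_i f i ^+ 2.
Proof. by apply: sumr_ge0 => i _; exact: sqr_ge0. Qed.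

Lemma cauchy_schwarz (I : finType) (f g : I -> R) :
  (\sum_i f i * g i) ^+ 2 <= (\sum_i f i ^+ 2) * \sum_i g i ^+ 2.
Proof.
set P := \sum_i f i * g i; set F := \sum_i f i ^+ 2; set G := \sum_i g i ^+ 2.
have G0 : 0 <= G := sum_sqr_ge0 g.
have [G_eq0|G_neq0] := eqVneq G 0.
  suff -> : P = 0 by rewrite expr0n /= G_eq0 mulr0.
  apply: big1 => i _.
  have /eqP := psumr_eq0P (fun i _ => sqr_ge0 (g i)) G_eq0 (i := i) isT.
  by rewrite sqrf_eq0 => /eqP ->; rewrite mulr0.
have G_gt0 : 0 < G by rewrite lt_def G_neq0.
rewrite -subr_ge0 -(pmulr_rge0 _ G_gt0).
have -> : G * (F * G - P ^+ 2) = \sum_i (G * f i - P * g i) ^+ 2.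
  transitivity (\sum_i (G ^+ 2 * f i ^+ 2 - 2 * G * P * (f i * g i)
                        + P ^+ 2 * g i ^+ 2)); last first.
    by apply: eq_bigr => i _; ring.
  rewrite big_split sumrB /= -!mulr_sumr -/P -/F -/G; ring.
exact: sum_sqr_ge0.
Qed.

Definition mxdot m n (B C : 'M[R]_(m, n)) : R := \tr (B^T *m C).

Lemma mxdotE m n (B C : 'M[R]_(m, n)) :
  mxdot B C = \sum_i \sum_j B i j * C i j.
Proof.
rewrite /mxdot /mxtrace exchange_big /=; apply: eq_bigr => j _.
by rewrite mxE; apply: eq_bigr => i _; rewrite mxE.
Qed.

Lemma mxdotC m n (B C : 'M[R]_(m, n)) : mxdot B C = mxdot C B.
Proof. by rewrite /mxdot -mxtrace_tr trmx_mul trmxK. Qed.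

Lemma mxdotDr m n (B C D : 'M[R]_(m, n)) :
  mxdot B (C + D) = mxdot B C + mxdot B D.
Proof. by rewrite /mxdot mulmxDr mxtraceD. Qed.

Lemma mxdotDl m n (B C D : 'M[R]_(m, n)) :
  mxdot (B + C) D = mxdot B D + mxdot C D.
Proof. by rewrite ![mxdot _ D]mxdotC mxdotDr. Qed.

Lemma mxdot0r m n (B : 'M[R]_(m, n)) : mxdot B 0 = 0.
Proof. by rewrite /mxdot mulmx0 mxtrace0. Qed.

Lemma mxdot_mulmxl m n p (B : 'M[R]_(m, n)) (C : 'M[R]_(n, p)) D :
  mxdot (B *m C) D = mxdot C (B^T *m D).
Proof. by rewrite /mxdot trmx_mul mulmxA. Qed.

Lemma mxdot_mulmxr m n p (B : 'M[R]_(m, n)) (C : 'M[R]_(n, p)) D :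
  mxdot (B *m C) D = mxdot B (D *m C^T).
Proof. by rewrite /mxdot trmx_mul -mulmxA mxtrace_mulC mulmxA. Qed.

Lemma normF_ge0 m n (B : 'M[R]_(m, n)) : 0 <= normF B.
Proof. exact: sqrtr_ge0. Qed.

Lemma normF_sqr m n (B : 'M[R]_(m, n)) :
  normF B ^+ 2 = \sum_i \sum_j B i j ^+ 2.
Proof.
by rewrite sqr_sqrtr //; apply: sumr_ge0 => i _; exact: sum_sqr_ge0.
Qed.

Lemma mxdot_normF m n (B : 'M[R]_(m, n)) : mxdot B B = normF B ^+ 2.
Proof.
by rewrite mxdotE normF_sqr; do 2!apply: eq_bigr => ? _; rewrite -expr2.
Qed.

Lemma normF_tr m n (B : 'M[R]_(m, n)) : normF B^T = normF B.
Proof.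
rewrite /normF exchange_big /=; congr Num.sqrt.
by do 2!apply: eq_bigr => ? _; rewrite mxE.
Qed.

Lemma normF_sqr_le0 m n (B : 'M[R]_(m, n)) : normF B ^+ 2 <= 0 -> B = 0.
Proof.
rewrite normF_sqr => B_le0.
have B0 : \sum_i \sum_j B i j ^+ 2 = 0.
  by apply/eqP; rewrite eq_le B_le0 sumr_ge0 // => i _; exact: sum_sqr_ge0.
apply/matrixP => i j; rewrite mxE.
have Bi := psumr_eq0P (fun i _ => sum_sqr_ge0 (B i)) B0 (i := i) isT.
have /eqP := psumr_eq0P (fun j _ => sqr_ge0 (B i j)) Bi (i := j) isT.
by rewrite sqrf_eq0 => /eqP.
Qed.

Lemma normF_mxdot_le m n (B C : 'M[R]_(m, n)) :
  mxdot B C <= normF B * normF C.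
Proof.
rewrite (le_trans (ler_norm _)) // -(@ler_pXn2r _ 2) ?nnegrE //; last first.
  by rewrite mulr_ge0 ?normF_ge0.
rewrite -normrX ger0_norm ?sqr_ge0 // exprMn !normF_sqr mxdotE !pair_bigA /=.
exact: cauchy_schwarz.
Qed.

Lemma normFD m n (B C : 'M[R]_(m, n)) : normF (B + C) <= normF B + normF C.
Proof.
rewrite -(@ler_pXn2r _ 2) ?nnegrE ?addr_ge0 ?normF_ge0 //.
rewrite -mxdot_normF mxdotDl !mxdotDr !mxdot_normF [mxdot C B]mxdotC.
have := normF_mxdot_le B C; nra.
Qed.

Lemma normF_mulmx m n p (B : 'M[R]_(m, n)) (C : 'M[R]_(n, p)) :
  normF (B *m C) <= normF B * normF C.
Proof.
rewrite -(@ler_pXn2r _ 2) ?nnegrE ?mulr_ge0 ?normF_ge0 // exprMn !normF_sqr.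
rewrite mulr_suml; apply: ler_sum => i _.
rewrite [X in _ * X]exchange_big mulr_sumr; apply: ler_sum => j _.
rewrite mxE; exact: cauchy_schwarz.
Qed.

Lemma normF_col n (x : 'cV[R]_n) : normF x = norm2 x.
Proof.
by rewrite /normF /norm2; congr Num.sqrt; apply: eq_bigr => i _; rewrite big_ord1.
Qed.

Lemma norm2Z n (s : R) (x : 'cV[R]_n) : norm2 (s *: x) ^+ 2 = s ^+ 2 * norm2 x ^+ 2.
Proof.
rewrite !sqr_sqrtr ?sum_sqr_ge0 // mulr_sumr.
by apply: eq_bigr => i _; rewrite mxE exprMn.
Qed.

Lemma normF_orthogonal n (V Z : 'M[R]_n) :
  V *m V^T = 1%:M -> normF (V *m Z *m V^T) ^+ 2 = normF Z ^+ 2.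
Proof.
move=> VVT; rewrite -!mxdot_normF mxdot_mulmxr trmxK -!mulmxA (mulmx1C VVT).
by rewrite mulmx1 mxdot_mulmxl mulmxA (mulmx1C VVT) mul1mx.
Qed.

End Frobenius.

(** * The spectral theorem for real symmetric matrices *)

Section Spectral.
Variable R : realType.

(** A complex eigenvector x + iy with eigenvalue s + it satisfies
    xT = sx - ty and yT = sy + tx; comparing <xT, y> with <x, yT> gives
    t (|x|^2 + |y|^2) = 0, so the eigenvalue is real and x or y is a real
    eigenvector. *)
Lemma symmetric_eigenvalue n (T : 'M[R]_n.+1) :
  T^T = T -> exists a, eigenvalue T a.
Proof.
move=> symT; have [[s t]] := Theorem7' (map_mx (real_complex R) T) isT.
move=> /eigenvalueP[v vT v_neq0].
pose x := map_mx (@complex.Re R) v; pose y := map_mx (@complex.Im R) v.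
have xT : x *m T = s *: x - t *: y.
  apply/rowP => j; move/rowP: vT => /(_ j); rewrite !mxE => /(congr1 (@complex.Re R)).
  rewrite raddf_sum /= => vTj; transitivity (complex.Re ((s +i* t) * v 0 j)).
    rewrite -vTj; apply: eq_bigr => i _; rewrite !mxE.
    by case: (v 0 i) => ? ? /=; ring.
  by case: (v 0 j) => ? ? /=.
have yT : y *m T = s *: y + t *: x.
  apply/rowP => j; move/rowP: vT => /(_ j); rewrite !mxE => /(congr1 (@complex.Im R)).
  rewrite raddf_sum /= => vTj; transitivity (complex.Im ((s +i* t) * v 0 j)).
    rewrite -vTj; apply: eq_bigr => i _; rewrite !mxE.
    by case: (v 0 i) => ? ? /=; ring.
  by case: (v 0 j) => ? ? /=; ring.
have xy_neq0 : (x != 0) || (y != 0).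
  rewrite -negb_and; apply: contra v_neq0 => /andP[/eqP x0 /eqP y0].
  apply/eqP/rowP => j; rewrite mxE.
  move/rowP: x0 => /(_ j); move/rowP: y0 => /(_ j); rewrite !mxE.
  by case: (v 0 j) => ? ? /= -> ->.
have t0 : t = 0.
  have : mxdot (x *m T) y = mxdot x (y *m T) by rewrite mxdot_mulmxr symT.
  rewrite xT yT /mxdot mulmxDr linearB mulmxBl raddfB raddfD /=.
  rewrite -!scalemxAr !linearZ /= -!scalemxAl !linearZ /=.
  rewrite -!/(mxdot _ _) !mxdot_normF => e.
  have /eqP : t * (normF x ^+ 2 + normF y ^+ 2) = 0 by move: e; rewrite /GRing.scale /=; lra.
  rewrite mulf_eq0 => /orP[/eqP //|/eqP nxy0].
  have nx := sqr_ge0 (normF x); have ny := sqr_ge0 (normF y).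
  by case/orP: xy_neq0 => /negP[]; apply/eqP/normF_sqr_le0; move: nxy0 nx ny; lra.
exists s; apply/eigenvalueP; case/orP: xy_neq0 => ?.
  by exists x => //; rewrite xT t0 scale0r subr0.
by exists y => //; rewrite yT t0 scale0r addr0.
Qed.

(** The reflection through the hyperplane orthogonal to w = v - e exchanges the
    two unit vectors e and v; it completes v to an orthonormal basis. *)
Lemma householder n (v : 'rV[R]_n.+1) : v *m v^T = 1%:M ->
  exists2 H : 'M[R]_n.+1, H *m H^T = 1%:M & delta_mx 0 0 *m H = v.
Proof.
pose e : 'rV[R]_n.+1 := delta_mx 0 0; rewrite -/e => vv.
have ee : e *m e^T = 1%:M.
  by rewrite trmx_delta mul_delta_mx; apply/matrixP => i j; rewrite !ord1 !mxE.
pose w := v - e.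
have [w0|w_neq0] := eqVneq w 0.
  exists 1%:M; first by rewrite trmx1 mulmx1.
  by rewrite mulmx1; move/eqP: w0; rewrite subr_eq0 => /eqP.
pose s := (w *m w^T) 0 0.
have ws : w *m w^T = s%:M by exact: mx11_scalar.
have s_neq0 : s != 0.
  apply: contra w_neq0 => /eqP s0; apply/eqP.
  rewrite -[w]trmxK; suff -> : w^T = 0 by rewrite trmx0.
  by apply: normF_sqr_le0; rewrite -mxdot_normF /mxdot trmxK trace_mx11 -/s s0.
(* v and e have the same norm, so e lies at distance |w|/2 from the mirror. *)
have ew : e *m w^T = (- s / 2)%:M.
  have vew : v *m e^T = e *m v^T.
    by rewrite [RHS]mx11_scalar [LHS]mx11_scalar -[v *m e^T]trmxK trmx_mul trmxK mxE.
  have -> : e *m w^T = - (2^-1 *: (w *m w^T)).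
    rewrite /w linearB /= mulmxBl !mulmxBr vew vv ee.
    by apply/matrixP => i j; rewrite !mxE; field.
  by rewrite ws; apply/matrixP => i j; rewrite !ord1 !mxE /= !mulr1n; field.
exists (1%:M - (2 / s) *: (w^T *m w)); last first.
  rewrite mulmxBr mulmx1 -scalemxAr mulmxA ew mul_scalar_mx scalerA.
  have -> : 2 / s * (- s / 2) = -1 by field.
  by rewrite scaleN1r opprK /w addrC subrK.
pose B := w^T *m w.
have BB : B *m B = s *: B.
  by rewrite /B mulmxA -[w^T *m w *m w^T]mulmxA ws mul_mx_scalar -scalemxAl.
have -> : (1%:M - (2 / s) *: B)^T = 1%:M - (2 / s) *: B.
  by rewrite raddfB /= trmx1 linearZ /= trmx_mul trmxK.
rewrite mulmxBl mul1mx mulmxBr mulmx1 -!scalemxAl -scalemxAr BB !scalerA.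
have -> : 2 / s * (2 / s) * s = 2 / s + 2 / s by field.
by apply/matrixP => i j; rewrite !mxE; ring.
Qed.

(** In an orthonormal basis that starts with a unit eigenvector, symmetry kills
    both the rest of the first row and the rest of the first column; the
    induction hypothesis applies to the remaining diagonal block. *)
Theorem symmetric_spectral n (T : 'M[R]_n) : T^T = T ->
  exists V : 'M[R]_n, exists2 d : 'rV[R]_n,
    V *m V^T = 1%:M & T = V^T *m diag_mx d *m V.
Proof.
elim: n T => [|n IHn] T symT; first by exists 0, 0; rewrite [LHS]flatmx0 [RHS]flatmx0.
have [a /eigenvalueP[v0 v0T v0_neq0]] := symmetric_eigenvalue symT.
pose s := (normF v0)^-1; pose v := s *: v0.
have nv0 : normF v0 != 0.
  by apply: contra v0_neq0 => /eqP nv0; rewrite [v0]normF_sqr_le0 // nv0 expr0n.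
have vv : v *m v^T = 1%:M.
  rewrite /v linearZ /= -scalemxAr -scalemxAl scalerA.
  have -> : v0 *m v0^T = (normF v0 ^+ 2)%:M.
    by rewrite [LHS]mx11_scalar -trace_mx11 mxtrace_mulC -/(mxdot _ _) mxdot_normF.
  by rewrite scale_scalar_mx -expr2 -exprMn mulVf // expr1n.
have vT : v *m T = a *: v by rewrite -scalemxAl v0T !scalerA mulrC.
have [H HHT eH] := householder vv.
have [S defS] : exists S : 'M[R]_(1 + n), S = H *m T *m H^T by eexists.
have symS : S^T = S by rewrite defS !trmx_mul trmxK symT mulmxA.
have S0 : delta_mx 0 0 *m S = a *: (delta_mx 0 0 : 'rV_(1 + n)).
  by rewrite defS !mulmxA eH vT -scalemxAl -eH -mulmxA HHT mulmx1.
have S0j j : S 0 j = a *+ (j == 0).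
  by move/rowP: S0 => /(_ j); rewrite -rowE !mxE eqxx /= mulr_natr.
have Sblock : S = block_mx a%:M 0 0 (drsubmx S).
  rewrite -[LHS]submxK; congr block_mx; apply/matrixP => i j; rewrite !mxE.
  - by rewrite !ord1 lshift0 S0j.
  - by rewrite !ord1 lshift0 S0j.
  - by rewrite -symS mxE !ord1 lshift0 S0j.
have [|V [d VVT dV]] := IHn (drsubmx S).
  by rewrite trmx_drsub symS.
pose K : 'M[R]_(1 + n) := block_mx 1%:M 0 0 V.
have KKT : K *m K^T = 1%:M.
  rewrite tr_block_mx mulmx_block !trmx0 !mulmx0 !mul0mx trmx1 mulmx1 VVT.
  by rewrite !addr0 add0r -scalar_mx_block.
have SK : S = K^T *m diag_mx (row_mx a%:M d) *m K.
  rewrite Sblock {1}dV diag_mx_row tr_block_mx !mulmx_block.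
  rewrite !trmx0 trmx1 !(mulmx0, mul0mx, addr0, add0r, mul1mx, mulmx1).
  by congr block_mx; apply/matrixP => i j; rewrite !ord1 !mxE.
exists (K *m H), (row_mx a%:M d).
  by rewrite trmx_mul mulmxA -(mulmxA K) HHT mulmx1.
transitivity (H^T *m S *m H); last by rewrite SK trmx_mul !mulmxA.
by rewrite defS !mulmxA (mulmx1C HHT) mul1mx -mulmxA (mulmx1C HHT) mulmx1.
Qed.

Lemma spectral_eigenvalue n (V T : 'M[R]_n) (d : 'rV[R]_n) i :
  V *m V^T = 1%:M -> T = V^T *m diag_mx d *m V -> eigenvalue T (d 0 i).
Proof.
move=> VVT defT; apply/eigenvalueP; exists (row i V).
  rewrite -row_mul defT !mulmxA VVT mul1mx; apply/rowP => j.
  by rewrite mxE mul_diag_mx !mxE.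
apply/eqP => Vi0; have /rowP/(_ i) : row i (V *m V^T) = 0 by rewrite row_mul Vi0 mul0mx.
by rewrite VVT !mxE eqxx => /eqP; rewrite oner_eq0.
Qed.

Lemma horner_mx_spectral n (V T : 'M[R]_n.+1) (d : 'rV[R]_n.+1) (p : {poly R}) :
  V *m V^T = 1%:M -> T = V^T *m diag_mx d *m V ->
  horner_mx T p = V^T *m diag_mx (map_mx (horner p) d) *m V.
Proof.
move=> VVT ->; have V_unit : V \in unitmx by case/mulmx1_unit: VVT.
have -> : V^T = invmx V by rewrite -[RHS]mulmx1 -VVT mulKmx.
by rewrite horner_mx_uconjC // horner_mx_diag.
Qed.

Lemma normF_orthogonal_mul m n p (V : 'M[R]_(m, n)) (B : 'M[R]_(n, p)) :
  V^T *m V = 1%:M -> normF (V *m B) = normF B.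
Proof.
move=> VTV; apply/eqP; rewrite -(@eqrXn2 _ 2) ?normF_ge0 //.
by rewrite -!mxdot_normF mxdot_mulmxl mulmxA VTV mul1mx.
Qed.

(** The operator norm of a symmetric matrix is its spectral radius, here in the
    form needed to bound a product in Frobenius norm. *)
Lemma normF_symmetric_mul n p (A : 'M[R]_n) (B : 'M[R]_(n, p)) (s : R) :
  A^T = A -> 0 <= s -> (forall t, eigenvalue A t -> `|t| <= s) ->
  normF (A *m B) <= s * normF B.
Proof.
move=> symA s_ge0 ev_le.
have [V [d VVT defA]] := symmetric_spectral symA.
have VTV := mulmx1C VVT; have VTTV : V^T^T *m V^T = 1%:M by rewrite trmxK.
rewrite -(normF_orthogonal_mul B VTV) defA -2!mulmxA normF_orthogonal_mul //.
rewrite -(@ler_pXn2r _ 2) ?nnegrE ?mulr_ge0 ?normF_ge0 // exprMn !normF_sqr.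
rewrite mulr_sumr; apply: ler_sum => i _; rewrite mulr_sumr.
apply: ler_sum => j _; rewrite mul_diag_mx !mxE exprMn.
rewrite ler_wpM2r ?sqr_ge0 // -(real_normK (num_real (d 0 i))).
by rewrite ler_pXn2r ?nnegrE // ev_le // (spectral_eigenvalue _ VVT defA).
Qed.

End Spectral.

(** * The Lyapunov operator and its energy *)

Section Lyapunov.
Variable R : realType.

Definition lyap n (T Z : 'M[R]_n) : 'M[R]_n := T *m Z + Z *m T.

Lemma lyapB n (T Z W : 'M[R]_n) : lyap T (Z - W) = lyap T Z - lyap T W.
Proof. by rewrite /lyap mulmxBr mulmxBl opprD addrACA. Qed.

(** In an eigenbasis of T the operator [lyap T] is diagonal, with d_i + d_j
    acting on entry (i, j). *)
Lemma lyap_energy_coord n (V T Z : 'M[R]_n) (d : 'rV[R]_n) :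
  V *m V^T = 1%:M -> T = V^T *m diag_mx d *m V ->
  mxdot Z (lyap T Z) =
    \sum_i \sum_j (d 0 i + d 0 j) * (V *m Z *m V^T) i j ^+ 2.
Proof.
move=> VVT defT; have VTV := mulmx1C VVT.
transitivity (mxdot (V *m Z *m V^T) (lyap (diag_mx d) (V *m Z *m V^T))).
  rewrite mxdot_mulmxr mxdot_mulmxl trmxK; congr mxdot.
  rewrite /lyap defT !mulmxDl mulmxDr !mulmxA VTV mul1mx; congr (_ + _).
  by rewrite -!mulmxA VTV mulmx1.
rewrite mxdotE; apply: eq_bigr => i _; apply: eq_bigr => j _.
rewrite /lyap [X in _ * X]mxE mul_diag_mx mul_mx_diag [X in _ * (X + _)]mxE.
rewrite [X in _ * (_ + X)]mxE; ring.
Qed.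

Lemma lyap_coercive n (T Z : 'M[R]_n) a : T^T = T ->
  (forall t, eigenvalue T t -> a <= t) ->
  2 * a * normF Z ^+ 2 <= mxdot Z (lyap T Z).
Proof.
move=> symT ev_ge; have [V [d VVT defT]] := symmetric_spectral symT.
rewrite (lyap_energy_coord Z VVT defT) -(normF_orthogonal Z VVT) normF_sqr.
rewrite mulr_sumr; apply: ler_sum => i _; rewrite mulr_sumr.
apply: ler_sum => j _; rewrite ler_wpM2r ?sqr_ge0 //.
have := ev_ge _ (spectral_eigenvalue i VVT defT).
have := ev_ge _ (spectral_eigenvalue j VVT defT); lra.
Qed.

Lemma lyap_inj n (T Z W : 'M[R]_n) a : T^T = T -> 0 < a ->
  (forall t, eigenvalue T t -> a <= t) -> lyap T Z = lyap T W -> Z = W.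
Proof.
move=> symT a_gt0 ev_ge eqL; apply/eqP; rewrite -subr_eq0; apply/eqP.
apply: normF_sqr_le0; have := lyap_coercive (Z - W) symT ev_ge.
by rewrite lyapB eqL subrr mxdot0r pmulr_rle0 // mulr_gt0.
Qed.

(** Coercivity and Cauchy-Schwarz give 2 a |Z| <= |L Z|, and then
    <Z, L Z> <= |Z| |L Z|. *)
Lemma lyap_energy_apriori n (T Z : 'M[R]_n) (a : R) (B : 'M[R]_n) :
  T^T = T -> 0 < a -> (forall t, eigenvalue T t -> a <= t) ->
  lyap T Z = B -> 2 * a * mxdot Z (lyap T Z) <= normF B ^+ 2.
Proof.
move=> symT a_gt0 ev_ge <-; set L := lyap T Z.
have coer := lyap_coercive Z symT ev_ge; rewrite -/L in coer.
have cs := normF_mxdot_le Z L.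
have z0 := normF_ge0 Z; have l0 := normF_ge0 L.
have zl : 2 * a * normF Z <= normF L.
  have [->|z_neq0] := eqVneq (normF Z) 0; first by rewrite mulr0.
  have z_gt0 : 0 < normF Z by rewrite lt_def z_neq0.
  rewrite -(ler_pM2r z_gt0); apply: le_trans (_ : _ <= mxdot Z L) _; last first.
    by rewrite mulrC.
  by move: coer; rewrite expr2; lra.
apply: le_trans (_ : 2 * a * (normF Z * normF L) <= _).
  by rewrite ler_wpM2l // mulr_ge0 // ltW.
by rewrite expr2 mulrA ler_wpM2r.
Qed.

Lemma lyap_sym n (T X : 'M[R]_n) a : T^T = T -> 0 < a ->
  (forall t, eigenvalue T t -> a <= t) ->
  (lyap T X)^T = lyap T X -> X^T = X.
Proof.
move=> symT a_gt0 ev_ge symL; apply: (lyap_inj symT a_gt0 ev_ge).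
by rewrite -symL /lyap linearD /= !trmx_mul symT addrC.
Qed.

(** Taking p(t) = q(-t) and X = q(T) Z q(T), the left side is the energy of
    r(T) X r(T) with r = p / q.  Stated through Z, so that no rational function
    of T has to be formed. *)
Lemma lyap_energy_horner_le n (T Z : 'M[R]_n.+1) (p q : {poly R}) (h : R)
    (E := fun f : {poly R} => horner_mx T f *m Z *m horner_mx T f) :
  T^T = T -> 0 <= h -> (forall t, eigenvalue T t -> 0 <= t) ->
  (forall t, eigenvalue T t -> p.[t] ^+ 2 <= h * q.[t] ^+ 2) ->
  mxdot (E p) (lyap T (E p)) <= h ^+ 2 * mxdot (E q) (lyap T (E q)).
Proof.
move=> symT h_ge0 ev_ge0 pq_le; have [V [d VVT defT]] := symmetric_spectral symT.
have ev i := spectral_eigenvalue i VVT defT.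
have hornerT := horner_mx_spectral _ VVT defT.
have coordE f i j : (V *m E f *m V^T) i j = f.[d 0 i] * f.[d 0 j] * (V *m Z *m V^T) i j.
  have -> : V *m E f *m V^T =
      diag_mx (map_mx (horner f) d) *m (V *m Z *m V^T) *m diag_mx (map_mx (horner f) d).
    by rewrite /E hornerT !mulmxA VVT mul1mx -!mulmxA VVT mulmx1.
  by rewrite mul_mx_diag mxE mul_diag_mx mxE ![map_mx _ _ _ _]mxE mulrAC.
rewrite !(lyap_energy_coord _ VVT defT) mulr_sumr; apply: ler_sum => i _.
rewrite mulr_sumr; apply: ler_sum => j _; rewrite !coordE.
set z := (V *m Z *m V^T) i j.
have -> : h ^+ 2 * ((d 0 i + d 0 j) * (q.[d 0 i] * q.[d 0 j] * z) ^+ 2) =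
   (d 0 i + d 0 j) * z ^+ 2 * ((h * q.[d 0 i] ^+ 2) * (h * q.[d 0 j] ^+ 2)) by ring.
have -> : (d 0 i + d 0 j) * (p.[d 0 i] * p.[d 0 j] * z) ^+ 2 =
   (d 0 i + d 0 j) * z ^+ 2 * (p.[d 0 i] ^+ 2 * p.[d 0 j] ^+ 2) by ring.
rewrite ler_wpM2l //.
  by rewrite mulr_ge0 ?sqr_ge0 // addr_ge0 // ev_ge0 // ev.
by apply: ler_pM; rewrite ?sqr_ge0 // pq_le // ev.
Qed.

(** Cea's lemma: the error X - U Y U^T is orthogonal to every U S U^T in the
    energy inner product, so replacing Y by Z adds the nonnegative energy of
    U (Y - Z) U^T. *)
Lemma galerkin_energy_optimal n k (T X : 'M[R]_n) (U : 'M[R]_(n, k))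
    (Y Z : 'M[R]_k) (err := fun S => X - U *m S *m U^T) :
  T^T = T -> (forall W : 'M[R]_n, 0 <= mxdot W (lyap T W)) ->
  U^T *m U = 1%:M ->
  lyap (U^T *m T *m U) Y = U^T *m lyap T X *m U ->
  mxdot (err Y) (lyap T (err Y)) <= mxdot (err Z) (lyap T (err Z)).
Proof.
move=> symT energy_ge0 UTU galerkin.
pose F := U *m (Y - Z) *m U^T; pose E := err Y.
have lyapC (B C : 'M[R]_n) : mxdot B (lyap T C) = mxdot C (lyap T B).
  by rewrite [RHS]mxdotC mxdotDl mxdot_mulmxl mxdot_mulmxr symT -mxdotDr.
have orth : mxdot F (lyap T E) = 0.
  rewrite /F /E /err mxdot_mulmxr mxdot_mulmxl trmxK lyapB mulmxA mulmxBr mulmxBl -galerkin.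
  set S := U^T *m lyap T _ *m U; suff -> : S = lyap (U^T *m T *m U) Y.
    by rewrite subrr mxdot0r.
  rewrite /S /lyap mulmxDr mulmxDl !mulmxA UTU mul1mx; congr (_ + _).
  by rewrite -!mulmxA UTU mulmx1.
have -> : err Z = E + F by rewrite /E /F /err mulmxBr mulmxBl addrA subrK.
have -> : lyap T (E + F) = lyap T E + lyap T F.
  by rewrite -[F]opprK lyapB /lyap !(mulmxN, mulNmx) -opprD !opprK.
rewrite (mxdotDl E F) !(mxdotDr _ (lyap T E)) (lyapC E F) orth addr0 add0r.
by rewrite lerDl.
Qed.

End Lyapunov.

(** * Error of the rational Galerkin projection *)

Section RationalGalerkin.
Variable R : realType.

Lemma horner_mx_sym n (T : 'M[R]_n.+1) (p : {poly R}) :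
  T^T = T -> (horner_mx T p)^T = horner_mx T p.
Proof.
move=> symT; have [V [d VVT defT]] := symmetric_spectral symT.
by rewrite (horner_mx_spectral p VVT defT) !trmx_mul trmxK tr_diag_mx mulmxA.
Qed.

Lemma horner_mx_symmetric_unit n (T : 'M[R]_n.+1) (p : {poly R}) :
  T^T = T -> (forall t, eigenvalue T t -> p.[t] != 0) ->
  horner_mx T p \in unitmx.
Proof.
move=> symT p_neq0; have [V [d VVT defT]] := symmetric_spectral symT.
have [V_unit VT_unit] := mulmx1_unit VVT.
rewrite (horner_mx_spectral p VVT defT) !unitmx_mul V_unit VT_unit /= andbT.
rewrite unitmxE det_diag unitfE prodf_seq_neq0; apply/allP => i _ /=.
by rewrite mxE p_neq0 // (spectral_eigenvalue _ VVT defT).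
Qed.

(** D p measures how far p(T) W is from W p(-T).  Substituting
    T W = w w^T - W T gives D (X p + c) = p(T) w w^T - D p T, so by induction
    the columns of D p lie in the span of the vectors f(T) w with deg f < deg p.
    Membership in a space is expressed by a matrix P that fixes its vectors. *)
Lemma krylov_displacement n k (T W P : 'M[R]_n.+1) (w : 'cV[R]_n.+1)
    (D := fun p => horner_mx T p *m W - W *m horner_mx T (p \Po - 'X)) :
  lyap T W = w *m w^T ->
  (forall p : {poly R}, (size p <= k)%N ->
     P *m (horner_mx T p *m w) = horner_mx T p *m w) ->
  forall p : {poly R}, (size p <= k.+1)%N -> P *m D p = D p.
Proof.
move=> lyapW Pw; elim/poly_ind => [|p c IHp] size_p.
  by rewrite /D comp_poly0 rmorph0 mul0mx !mulmx0 subr0 mulmx0.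
have size_p_le : (size p <= k)%N.
  move: size_p; rewrite size_MXaddC; case: ifP => // /andP[/eqP -> _].
  by rewrite size_poly0.
have -> : D (p * 'X + c%:P) = horner_mx T p *m w *m w^T - D p *m T.
  rewrite -mulmxA -lyapW /D /lyap comp_poly_MXaddC.
  rewrite !raddfD /= !rmorphM /= raddfN /= !horner_mx_X !horner_mx_C.
  rewrite -!mulmxE !mulmxDl !mulmxN opprK mulNmx mul_scalar_mx mul_mx_scalar.
  by rewrite !mulmxA opprB addrACA subrr addr0 [RHS]addrACA subrr addr0.
rewrite mulmxBr !mulmxA -(mulmxA P) Pw // -!mulmxA (mulmxA P) IHp //.
by rewrite ltnW // ltnS.
Qed.

(** Moving one factor across W turns both q(T) W q(T) and q(-T) W q(-T) into
    W q(T) q(-T) plus a displacement whose columns lie in the Krylov space; the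
    two copies of W q(T) q(-T) cancel. *)
Lemma adi_in_krylov n k (T W P : 'M[R]_n.+1) (w : 'cV[R]_n.+1) (q : {poly R})
    (E := fun p => horner_mx T p *m W *m horner_mx T p) :
  lyap T W = w *m w^T ->
  (forall p : {poly R}, (size p <= k)%N ->
     P *m (horner_mx T p *m w) = horner_mx T p *m w) ->
  (size q <= k.+1)%N ->
  P *m (E q - E (q \Po - 'X)) = E q - E (q \Po - 'X).
Proof.
move=> lyapW Pw size_q; pose r := q \Po - 'X; rewrite -/r.
have rK : r \Po - 'X = q.
  by rewrite /r -comp_polyA raddfN /= comp_polyX opprK comp_polyXr.
have size_r : (size r <= k.+1)%N.
  by rewrite size_comp_poly2 // size_polyN size_polyX.
have Dq := krylov_displacement lyapW Pw size_q.
have Dr := krylov_displacement lyapW Pw size_r; rewrite rK -/r in Dq Dr.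
have -> : E q - E r =
    (horner_mx T q *m W - W *m horner_mx T r) *m horner_mx T q
    - (horner_mx T r *m W - W *m horner_mx T q) *m horner_mx T r.
  rewrite !mulmxBl -!(mulmxA W).
  have -> : horner_mx T r *m horner_mx T q = horner_mx T q *m horner_mx T r.
    exact: comm_horner_mx2.
  by rewrite opprB addrA subrK.
by rewrite mulmxBr !mulmxA Dq Dr.
Qed.

(** Compare the Galerkin error with the ADI error r(T) X r(T), r(t) = q(-t)/q(t),
    in energy norm; the bound is a consequence of coercivity on one side and of
    the a priori energy of X on the other. *)
Theorem rational_galerkin_error n k (T X : 'M[R]_n.+1) (b : 'cV[R]_n.+1)
    (q : {poly R}) (U : 'M[R]_(n.+1, k)) (Y : 'M[R]_k) (a h : R) :
  T^T = T -> 0 < a -> 0 <= h -> (forall t, eigenvalue T t -> a <= t) ->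
  (size q <= k.+1)%N -> (forall t, eigenvalue T t -> q.[t] != 0) ->
  (forall t, eigenvalue T t -> q.[- t] ^+ 2 <= h * q.[t] ^+ 2) ->
  U^T *m U = 1%:M ->
  (forall p : {poly R}, (size p <= k)%N ->
     exists y, horner_mx T p *m (invmx (horner_mx T q) *m b) = U *m y) ->
  lyap T X = b *m b^T ->
  lyap (U^T *m T *m U) Y = (U^T *m b) *m (U^T *m b)^T ->
  2 * a * normF (X - U *m Y *m U^T) <= h * norm2 b ^+ 2.
Proof.
move=> symT a_gt0 h_ge0 ev_ge size_q q_neq0 ratio_le UTU krylovU lyapX lyapY.
have symX : X^T = X.
  by apply: (lyap_sym symT a_gt0 ev_ge); rewrite lyapX trmx_mul trmxK.
(* W is the solution for the Krylov starting vector w = q(T)^-1 b. *)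
pose qT := horner_mx T q; pose W := invmx qT *m X *m invmx qT.
have qT_unit : qT \in unitmx := horner_mx_symmetric_unit symT q_neq0.
have symqTV : (invmx qT)^T = invmx qT by rewrite trmx_inv horner_mx_sym.
have commTV : T *m invmx qT = invmx qT *m T.
  rewrite -[LHS]mul1mx -(mulVmx qT_unit) -mulmxA; congr (_ *m _).
  rewrite mulmxA; have -> : qT *m T = T *m qT.
    exact: comm_horner_mx (comm_mx_refl T).
  by rewrite mulmxK.
have lyapW : lyap T W = (invmx qT *m b) *m (invmx qT *m b)^T.
  rewrite trmx_mul symqTV mulmxA -(mulmxA (invmx qT)) -lyapX.
  rewrite /lyap /W mulmxDr mulmxDl !mulmxA commTV; congr (_ + _).
  by rewrite -!mulmxA commTV.
pose E p := horner_mx T p *m W *m horner_mx T p; pose r := q \Po - 'X.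
have Eq : E q = X by rewrite /E /W !mulmxA mulmxV // mul1mx mulmxKV.
have symE p : (E p)^T = E p.
  by rewrite /E /W !trmx_mul symX symqTV horner_mx_sym // !mulmxA.
(* S is the ADI approximation; X - S = r(T) W r(T) with r(t) = q(-t). *)
pose S := X - E r.
have PS : U *m U^T *m S = S.
  rewrite /S -Eq; apply: (adi_in_krylov lyapW _ size_q) => p size_p.
  by have [y ->] := krylovU p size_p; rewrite mulmxA -(mulmxA U) UTU mulmx1.
have symS : S^T = S by rewrite /S linearB /= symX symE.
(* S is symmetric, so its rows lie in the Krylov space too. *)
have SU : S = U *m (U^T *m S *m U) *m U^T.
  by rewrite -{1}PS -{1}symS -{1}PS !trmx_mul trmxK symS !mulmxA.
have energy_ge0 (Z : 'M[R]_n.+1) : 0 <= mxdot Z (lyap T Z).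
  apply: le_trans (lyap_coercive Z symT ev_ge).
  by rewrite mulr_ge0 ?sqr_ge0 // mulr_ge0 // ltW.
have ev_ge0 t : eigenvalue T t -> 0 <= t.
  by move=> /ev_ge; apply: le_trans; exact: ltW.
have galerkin : lyap (U^T *m T *m U) Y = U^T *m lyap T X *m U.
  by rewrite lyapY lyapX trmx_mul trmxK !mulmxA.
have opt := galerkin_energy_optimal (U^T *m S *m U) symT energy_ge0 UTU galerkin.
rewrite -SU /S subKr in opt.
have ratio_le' t : eigenvalue T t -> r.[t] ^+ 2 <= h * q.[t] ^+ 2.
  by move=> /ratio_le; rewrite /r horner_comp hornerN hornerX.
have adi := lyap_energy_horner_le W symT h_ge0 ev_ge0 ratio_le'.
rewrite -/(E r) -/(E q) Eq in adi.
have apriori := lyap_energy_apriori symT a_gt0 ev_ge lyapX.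
set err := X - _ in opt *; have coer := lyap_coercive err symT ev_ge.
have nb : normF (b *m b^T) <= norm2 b ^+ 2.
  by rewrite (le_trans (normF_mulmx _ _)) // normF_tr normF_col expr2.
have a2 : 0 < 2 * a by rewrite mulr_gt0.
rewrite -(@ler_pXn2r _ 2) ?nnegrE ?mulr_ge0 ?normF_ge0 ?sqrtr_ge0 ?(ltW a_gt0) //.
have -> : (2 * a * normF err) ^+ 2 = 2 * a * (2 * a * normF err ^+ 2) by ring.
apply: le_trans (_ : 2 * a * (h ^+ 2 * mxdot X (lyap T X)) <= _).
  by rewrite (ler_pM2l a2) (le_trans coer) // (le_trans opt).
rewrite mulrCA exprMn ler_wpM2l ?sqr_ge0 // (le_trans apriori) //.
by rewrite ler_pXn2r ?nnegrE ?normF_ge0 ?sqr_ge0.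
Qed.

End RationalGalerkin.

(** * The pole polynomial and the pole ratio *)

Section Poles.
Import numFieldNormedType.Exports.
Variable R : realType.
Local Notation toC := (real_complex R).

(** Conjugation permutes the linear factors, so the coefficients are real. *)
Lemma real_pole_poly (xi : seq R[i]) : conj_closed xi ->
  exists q : {poly R}, map_poly toC q = pole_poly xi.
Proof.
move=> xi_conj; exists (map_poly (@complex.Re R) (pole_poly xi)).
have conj_inv : map_poly conjc (pole_poly xi) = pole_poly xi.
  rewrite {1}/pole_poly rmorph_prod /= -[RHS](perm_big _ xi_conj) big_map /=.
  by apply: eq_bigr => z _; rewrite map_polyXsubC.
apply/polyP => i; rewrite coef_map /= coef_map_id0 //.
have /(congr1 (fun p : {poly R[i]} => p`_i)) := conj_inv.
rewrite coef_map; case: (_`_i) => x y /= [].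
by move=> yN; rewrite (_ : y = 0) //; move: yN; lra.
Qed.

Lemma normc_real_sqr (x : R) : Normc.normc (x%:C) ^+ 2 = x ^+ 2.
Proof. by rewrite /= expr0n addr0 sqr_sqrtr ?sqr_ge0. Qed.

Lemma normc_prod (I : Type) (s : seq I) (f : I -> R[i]) :
  Normc.normc (\prod_(i <- s) f i) = \prod_(i <- s) Normc.normc (f i).
Proof.
by apply: (big_morph _ (@Normc.normcM R)); exact: Normc.normc1.
Qed.

Lemma sup_nonneg (E : set R) : (forall y, E y -> 0 <= y) -> 0 <= sup E.
Proof.
move=> E_ge0; have [[[y Ey] ubE]|/sup_out -> //] := pselect (has_sup E).
exact: le_trans (E_ge0 y Ey) (ub_le_sup ubE Ey).
Qed.

Section RealPolePoly.
Variables (xi : seq R[i]) (q : {poly R}).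
Hypothesis qE : map_poly toC q = pole_poly xi.

Lemma size_real_pole_poly : size q = (size xi).+1.
Proof. by rewrite -(size_map_poly toC) qE size_prod_XsubC. Qed.

Lemma real_pole_poly_root (x : R) : root q x = (x%:C \in xi).
Proof. by rewrite -(fmorph_root toC) qE root_prod_XsubC. Qed.

Lemma real_pole_poly_sqr (x : R) :
  q.[x] ^+ 2 = \prod_(z <- xi) Normc.normc (x%:C - z) ^+ 2.
Proof.
rewrite prodrXl -normc_prod -normc_real_sqr; congr (Normc.normc _ ^+ 2).
rewrite -[LHS]/(toC _) -horner_map /= qE horner_prod.
by apply: eq_bigr => z _; rewrite hornerXsubC.
Qed.

(** For real x, the modulus of -x - z is that of x + conj z; this is where the
    conjugate in the numerator of the pole ratio comes from. *)
Lemma real_pole_polyN_sqr (x : R) :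
  q.[- x] ^+ 2 = \prod_(z <- xi) Normc.normc (x%:C + conjc z) ^+ 2.
Proof.
rewrite real_pole_poly_sqr; apply: eq_bigr => -[u v] _ /=.
by rewrite !sqr_sqrtr ?addr_ge0 ?sqr_ge0 //; ring.
Qed.

Lemma pole_ratioE (a b : R) :
  pole_ratio xi a b = sup [set q.[- x] ^+ 2 / q.[x] ^+ 2 | x in `[a, b]].
Proof.
congr sup; apply: eq_imagel => x _.
by rewrite real_pole_polyN_sqr real_pole_poly_sqr.
Qed.

Lemma pole_ratio_ge0 (a b : R) : 0 <= pole_ratio xi a b.
Proof.
rewrite pole_ratioE; apply: sup_nonneg => _ [x _ <-].
by rewrite divr_ge0 ?sqr_ge0.
Qed.

(** The quotient is continuous where q does not vanish, so it is bounded on the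
    compact interval [a, b]; without that bound the supremum would say nothing. *)
Lemma pole_ratio_bound (a b : R) :
  (forall x : R, a <= x <= b -> x%:C \notin xi) ->
  forall x, a <= x <= b -> q.[- x] ^+ 2 <= pole_ratio xi a b * q.[x] ^+ 2.
Proof.
move=> no_pole.
have q_neq0 x : a <= x <= b -> q.[x] != 0.
  by move=> /no_pole; rewrite -real_pole_poly_root.
move=> x xab; have le_ab : a <= b by case/andP: xab; exact: le_trans.
pose f t := (q \Po - 'X).[t] ^+ 2 / q.[t] ^+ 2.
have fE t : f t = q.[- t] ^+ 2 / q.[t] ^+ 2.
  by rewrite /f horner_comp hornerN hornerX.
have cont_f : {within `[a, b], continuous f}.
  apply: continuous_in_subspaceT => t; rewrite inE /= in_itv /= => /q_neq0 qt_neq0.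
  have cont2 (p : {poly R}) : (p.[s] ^+ 2 @[s --> t] --> p.[t] ^+ 2).
    by apply: cvgM; exact: continuous_horner.
  by apply: cvgM => //; apply: cvgV => //; rewrite expf_neq0.
have [m _ f_max] := EVT_max le_ab cont_f.
rewrite -ler_pdivrMr ?exprn_even_gt0 ?q_neq0 // pole_ratioE.
apply: ub_le_sup; last by exists x => //=; rewrite in_itv.
by exists (f m) => _ [t /= tab <-]; rewrite -fE; apply: f_max.
Qed.

Lemma rat_krylov_span n k (T : 'M[R]_n.+1) (b : 'cV[R]_n.+1)
    (U : 'M[R]_(n.+1, k)) :
  orthonormal_basis U (rat_krylov T b xi) ->
  forall p : {poly R}, (size p <= size xi)%N ->
    exists y, horner_mx T p *m (invmx (horner_mx T q) *m b) = U *m y.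
Proof.
move=> [_ spanU] p size_p.
have : rat_krylov T b xi (horner_mx T p *m (invmx (horner_mx T q) *m b)).
  exists p => //; rewrite -qE -!map_horner_mx -map_invmx -!map_mxM.
  by rewrite mulmxA.
by rewrite spanU => -[y _ <-]; exists y.
Qed.

End RealPolePoly.
End Poles.

(** * The Lanczos residual *)

Section Residual.
Variable R : realType.

Lemma spnorm_ge0 m n (B : 'M[R]_(m, n)) : 0 <= spnorm B.
Proof.
apply: sup_nonneg => _ [x _ <-].
by rewrite divr_ge0 ?sqrtr_ge0.
Qed.

Lemma eps0_ge0 N (eps : R) : 0 <= eps -> 0 <= eps0 N eps.
Proof. by move=> eps_ge0; rewrite !mulr_ge0 // addr_ge0. Qed.

Lemma eps2_ge0 N (A : 'M[R]_N) (eps : R) : 0 <= eps -> 0 <= eps2 A eps.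
Proof.
by move=> eps_ge0; rewrite mulr_ge0 ?sqrtr_ge0 // le_max mulr_ge0 ?eps0_ge0.
Qed.

Lemma residual_perturbation N M (A : 'M[R]_N) (B : 'M[R]_N) (Q : 'M[R]_(N, M))
    (X X' : 'M[R]_M) (s : R) :
  A^T = A -> 0 <= s -> (forall t, eigenvalue A t -> `|t| <= s) ->
  normF (A *m (Q *m X' *m Q^T) + Q *m X' *m Q^T *m A - B)
  <= normF (A *m (Q *m X *m Q^T) + Q *m X *m Q^T *m A - B)
     + 2 * s * normF Q ^+ 2 * normF (X - X').
Proof.
move=> symA s_ge0 ev_le; pose G := Q *m (X' - X) *m Q^T.
set rho := (X in _ <= normF X + _).
have -> : A *m (Q *m X' *m Q^T) + Q *m X' *m Q^T *m A - B = rho + (A *m G + G *m A).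
  have -> : Q *m X' *m Q^T = Q *m X *m Q^T + G.
    by rewrite /G mulmxBr mulmxBl addrC subrK.
  by rewrite mulmxDr mulmxDl (addrACA (A *m _)) [LHS]addrAC.
have nG : normF G <= normF Q ^+ 2 * normF (X - X').
  have -> : normF Q ^+ 2 * normF (X - X') = normF Q * normF (X' - X) * normF Q^T.
    have -> : normF (X - X') = normF (X' - X).
      rewrite -opprB /normF; congr Num.sqrt.
      by do 2!apply: eq_bigr => ? _; rewrite mxE sqrrN.
    by rewrite normF_tr; ring.
  apply: le_trans (normF_mulmx _ _) _; rewrite ler_wpM2r ?normF_ge0 //.
  exact: normF_mulmx.
have nAG := normF_symmetric_mul G symA s_ge0 ev_le.
have nGA : normF (G *m A) <= s * normF G.
  rewrite -normF_tr trmx_mul symA -(normF_tr G).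
  exact: normF_symmetric_mul.
apply: le_trans (normFD _ _) _; rewrite lerD2l.
apply: le_trans (normFD _ _) _; apply: le_trans (lerD nAG nGA) _.
have := ler_wpM2l s_ge0 nG; lra.
Qed.

End Residual.

Theorem theorem4p2 (R : realType) (N m k : nat) (eps : R)
    (A : 'M[R]_N) (c : 'cV[R]_N) (lmin lmax : R)
    (q : nat -> 'cV[R]_N) (alpha beta : nat -> R)
    (xi : k.-tuple R[i])
    (X : 'M[R]_m.+1) (U : 'M[R]_(m.+1, k)) (Y : 'M[R]_k) :
  let M := m.+1 in
  let e1 : 'cV[R]_m.+1 := delta_mx 0 0 in
  let eM : 'cV[R]_m.+1 := delta_mx ord_max 0 in
  let Q := lanczos_basis q m.+1 in
  let QM1 := lanczos_basis q m.+2 in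
  let T := lanczos_tridiag alpha beta m.+1 in
  let ep0 := eps0 N eps in
  let ep1 := eps1 A eps in
  let ep2 := eps2 A eps in
  let a := lmin - M%:R `^ (5 / 2) * ep2 * spnorm A in
  let b := lmax + M%:R `^ (5 / 2) * ep2 * spnorm A in
  let rho := A *m Q *m X *m Q^T + Q *m X *m Q^T *m A - c *m c^T in
  let Xref := Q *m U *m Y *m U^T *m Q^T in
  let C3 := 2 * (1 + 2 * ep0) * M%:R * lmax / a in
  (M < N)%N ->
  0 < eps ->
  posdefmx A -> min_eigenvalue A lmin -> max_eigenvalue A lmax ->
  fl_lanczos eps A c q alpha beta M ->
  normF (A *m Q - (Q *m T + beta M *: (q M.+1 *m eM^T)))
    <= Num.sqrt M%:R * ep1 * spnorm A ->
  (forall t, eigenvalue T t -> a <= t <= b) ->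
  normF Q <= Num.sqrt ((1 + 2 * ep0) * M%:R) ->
  normF QM1 <= Num.sqrt ((1 + 2 * ep0) * M.+1%:R) ->
  M.+1%:R `^ (5 / 2) * ep2 * spnorm A < lmin ->
  conj_closed xi ->
  (forall x : R, a <= x <= b -> x%:C \notin xi) ->
  T *m X + X *m T = norm2 c ^+ 2 *: (e1 *m e1^T) ->
  orthonormal_basis U (rat_krylov T e1 xi) ->
  U^T *m T *m U *m Y + Y *m (U^T *m T *m U)
    = norm2 c ^+ 2 *: ((U^T *m e1) *m (U^T *m e1)^T) ->
  normF (A *m Xref + Xref *m A - c *m c^T) / norm2 c ^+ 2
    <= normF rho / norm2 c ^+ 2 + C3 * pole_ratio xi a b.
Proof.
move=> M e1 eM Q QM1 T ep0 ep1 ep2 a b rho Xref C3 _ eps_gt0 [symA _].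
move=> [_ lmin_le] [lmax_ev lmax_ge] _ _ evT nQ _ margin xi_conj no_pole.
move=> lyapX basisU lyapY; have [UTU _] := basisU.
have ep0_ge0 : 0 <= ep0 := eps0_ge0 N (ltW eps_gt0).
have ep2A_ge0 : 0 <= ep2 * spnorm A.
  by rewrite mulr_ge0 ?spnorm_ge0 ?eps2_ge0 // ltW.
have a_gt0 : 0 < a.
  rewrite subr_gt0; apply: le_lt_trans margin; rewrite -!(mulrA _ ep2) ler_wpM2r //.
  by apply: ge0_ler_powR; rewrite ?nnegrE ?ler_nat ?ler0n ?divr_ge0 //; exact: leqnSn.
have lmin_gt0 : 0 < lmin.
  by apply: le_lt_trans margin; rewrite -(mulrA _ ep2) mulr_ge0 ?powR_ge0.
have lmax_ge0 : 0 <= lmax by rewrite ltW // (lt_le_trans lmin_gt0) ?lmin_le.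
have evA t : eigenvalue A t -> `|t| <= lmax.
  by move=> At; rewrite ger0_norm ?lmax_ge // ltW // (lt_le_trans lmin_gt0) ?lmin_le.
have symT : T^T = T.
  apply/matrixP => i j; rewrite !mxE eq_sym; case: eqP => [-> //|_].
  by do 2!case: eqP => //; lia.
have [p pE] := real_pole_poly xi_conj.
pose h := pole_ratio xi a b.
have h_ge0 : 0 <= h := pole_ratio_ge0 pE a b.
have size_p : (size p <= k.+1)%N by rewrite (size_real_pole_poly pE) size_tuple.
pose s := norm2 c.
have err_le : 2 * a * normF (X - U *m Y *m U^T) <= h * s ^+ 2.
  have -> : s ^+ 2 = norm2 (s *: e1) ^+ 2.
    rewrite norm2Z -normF_col -mxdot_normF /mxdot trmx_delta mul_delta_mx.
    by rewrite trace_mx11 mxE mulr1.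
  apply: (rational_galerkin_error (T := T) (q := p)) => //.
  - by move=> t /evT /andP[].
  - by move=> t /evT /no_pole; rewrite -(real_pole_poly_root pE).
  - by move=> t /evT; exact: (pole_ratio_bound pE no_pole).
  - move=> f size_f; have [|y fE] := rat_krylov_span pE basisU (p := f).
      by rewrite size_tuple.
    by exists (s *: y); rewrite -!scalemxAr fE.
  - by rewrite /lyap lyapX linearZ /= -scalemxAl -scalemxAr scalerA.
  - by rewrite /lyap lyapY -scalemxAr linearZ /= -scalemxAl -scalemxAr scalerA.
have w_ge0 : 0 <= (1 + 2 * ep0) * M%:R by rewrite mulr_ge0 // addr_ge0 // mulr_ge0.
have nQ2 : normF Q ^+ 2 <= (1 + 2 * ep0) * M%:R.
  by rewrite -(sqr_sqrtr w_ge0) ler_pXn2r ?nnegrE ?normF_ge0 ?sqrtr_ge0.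
have res_le : normF (A *m Xref + Xref *m A - c *m c^T)
    <= normF rho + C3 * h * s ^+ 2.
  have -> : Xref = Q *m (U *m Y *m U^T) *m Q^T by rewrite /Xref !mulmxA.
  have -> : rho = A *m (Q *m X *m Q^T) + Q *m X *m Q^T *m A - c *m c^T.
    by rewrite /rho !mulmxA.
  apply: le_trans (residual_perturbation _ Q X _ symA lmax_ge0 evA) _.
  rewrite lerD2l; set err := normF (X - _) in err_le *.
  have err_ge0 : 0 <= err := normF_ge0 _.
  apply: le_trans (_ : 2 * lmax * ((1 + 2 * ep0) * M%:R) * err <= _).
    by rewrite ler_wpM2r // ler_wpM2l // mulr_ge0.
  have -> : C3 * h * s ^+ 2 = 2 * lmax * ((1 + 2 * ep0) * M%:R) * (h * s ^+ 2 / a).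
    by rewrite /C3; field; rewrite gt_eqF.
  rewrite ler_wpM2l //; first by rewrite mulr_ge0 // mulr_ge0.
  rewrite ler_pdivlMr //; move: err_le.
  have : 0 <= a * err by rewrite mulr_ge0 // ltW.
  lra.
(* If c = 0, both quotients by its norm are 0 by convention. *)
have [s0|s_neq0] := eqVneq (s ^+ 2) 0.
  rewrite -/s s0 invr0 !mulr0 add0r mulr_ge0 //.
  by rewrite /C3 mulr_ge0 ?invr_ge0 ?(ltW a_gt0) // !mulr_ge0 // addr_ge0 // mulr_ge0.
have s2_gt0 : 0 < s ^+ 2 by rewrite lt_def s_neq0 sqr_ge0.
by rewrite -/s ler_pdivrMr // mulrDl mulfVK.
Qed.
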